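(* Let $n\ge 1$ be an integer and let $f_1,\dots,f_n:\mathbb{R}\to\mathbb{R}$ be continuous functions. Assume that $$\sup_{t\in\mathbb{R}}\sum_{k=1}^n\int_0^tf_k(s)\,ds>0$$ and that $$\lim_{|s|\to\infty}\frac{f_k(s)}{s}=\lim_{s\to0}\frac{f_k(s)}{s}=0\qquad\text{for every }k\in\{1,\dots,n\}.$$ Then there exist a nonempty open interval $\Lambda\subset(0,+\infty)$ and a number $\gamma>0$ such that for every $\lambda\in\Lambda$ the problem $$\begin{cases}\Delta^4u_{k-2}=\lambda f_k(u_k), & \forall k\in\{1,\dots,n\},\\ u_{-2}=u_{-1}=u_0=0,\\ u_{n+1}=u_{n+2}=u_{n+3}=0,\end{cases}$$ has at least two distinct nontrivial (i.e. nonzero) solutions $u_\lambda^1,u_\lambda^2\in\mathbb{R}^n$, and $\|u_\lambda^i\|_2<\gamma$ for $i\in\{1,2\}$.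
   Context: $\Delta$ is the forward difference operator, $\Delta u_k:=u_{k+1}-u_k$, and $\Delta^4$ is its fourth iterate, so $\Delta^4u_{k-2}=u_{k+2}-4u_{k+1}+6u_k-4u_{k-1}+u_{k-2}$. A solution is identified with the vector $u=(u_1,\dots,u_n)\in\mathbb{R}^n$ of its values at $1,\dots,n$, the values at $-2,-1,0,n+1,n+2,n+3$ being prescribed as $0$. $\|u\|_2:=(\sum_{k=1}^nu_k^2)^{1/2}$. *)

(* Defs.v *)
From HB Require Import structures.
From mathcomp Require Import all_boot all_order all_algebra.
From mathcomp Require Import all_classical all_reals all_analysis.

Set Implicit Arguments.
Unset Strict Implicit.
Unset Printing Implicit Defensive.

Import Order.TTheory GRing.Theory Num.Theory numFieldNormedType.Exports.

Local Open Scope classical_set_scope.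
Local Open Scope ring_scope.

(* The oriented integral of g from 0 to t: [Rintegral] only knows about sets,
   so the sign change for t < 0 has to be made explicit. *)
Definition int0 (R : realType) (g : R -> R) (t : R) : R :=
  if 0 <= t then \int[@lebesgue_measure R]_(s in `[0, t]) g s
  else - \int[@lebesgue_measure R]_(s in `[t, 0]) g s.

Definition fdiff (V : zmodType) (x : int -> V) (k : int) : V := x (k + 1) - x k.

(* The fourth-order difference problem for x : int -> R. The ordinal i : 'I_n
   stands for the index k = i + 1 in {1, ..., n}, so f i is the nonlinearity
   f_k. The values of x outside [-2, n + 3] play no role. *)
Definition bvp (R : realType) (n : nat) (f : 'I_n -> R -> R) (lambda : R)
    (x : int -> R) : Prop :=
  [/\ forall i : 'I_n,
        iter 4 (@fdiff R) x (i.+1%:Z - 2%:Z) = lambda * f i (x i.+1%:Z),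
      [/\ x (- 2%:Z) = 0, x (- 1%:Z) = 0 & x 0 = 0]
    & [/\ x n.+1%:Z = 0, x n.+2%:Z = 0 & x n.+3%:Z = 0]].

(* A solution is identified with the vector of its values at 1, ..., n. *)
Definition is_solution (R : realType) (n : nat) (f : 'I_n -> R -> R)
    (lambda : R) (u : 'rV[R]_n) : Prop :=
  exists2 x : int -> R, forall i : 'I_n, x i.+1%:Z = u 0 i & bvp f lambda x.

(* The norm `|u| of the library on 'rV[R]_n is the sup norm. *)
Definition norm2 (R : realType) (n : nat) (u : 'rV[R]_n) : R :=
  Num.sqrt (\sum_(i < n) u 0 i ^+ 2).

(* Main.v *)
Require Import Defs.
From HB Require Import structures.
From mathcomp Require Import all_boot all_order all_algebra.
From mathcomp Require Import all_classical all_reals all_analysis.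
From mathcomp Require Import zify ring lra.

Set Implicit Arguments.
Unset Strict Implicit.
Unset Printing Implicit Defensive.

Import Order.TTheory GRing.Theory Num.Theory numFieldNormedType.Exports.

Local Open Scope classical_set_scope.
Local Open Scope ring_scope.

(* The solutions are the zeros of A u - lambda f(u), where A is the symmetric
   matrix of the fourth difference with zero boundary values; this is the
   gradient of J(u) = Q(u)/2 - lambda * sum_k F_k(u_k), where
   Q(u) = <A u, u> is the sum of the squared second differences of u, hence
   positive definite.  Since F_k(s) = o(s^2) at infinity, J is coercive and has
   a global minimizer; since F_k(s) = o(s^2) at 0, J is bounded below by a
   positive constant on small spheres around the critical point 0.  If t is
   such that sum_k F_k(t) > 0 then J is negative at (t, ..., t) as soon as
   lambda > l0 := Q(t, ..., t) / (2 sum_k F_k(t)); then the minimizer lies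
   beyond the barrier, and a mountain pass between 0 and the minimizer yields a
   second nonzero critical point.  For lambda in ]l0, l0 + 1[ the identity
   Q(u) = lambda * sum_k u_k f_k(u_k) and the sublinearity of f_k at infinity
   bound all solutions uniformly. *)

(** * Critical points of coercive functions *)

Definition sqn (R : realType) (n : nat) (u : 'rV[R]_n) : R :=
  \sum_(i < n) u 0 i ^+ 2.

Lemma sqn_ge0 (R : realType) n (u : 'rV[R]_n) : 0 <= sqn u.
Proof. by apply: sumr_ge0 => i _; exact: sqr_ge0. Qed.

Lemma sqn_coord (R : realType) n (u : 'rV[R]_n) i : u 0 i ^+ 2 <= sqn u.
Proof.
by rewrite /sqn (bigD1 i)//= lerDl sumr_ge0// => j _; exact: sqr_ge0.
Qed.

Lemma sqn_eq0 (R : realType) n (u : 'rV[R]_n) : sqn u = 0 -> u = 0.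
Proof.
move=> u0; apply/rowP => i; rewrite mxE; apply/eqP.
by rewrite -sqrf_eq0 eq_le sqr_ge0 andbT -u0 sqn_coord.
Qed.

Lemma coord_cont (R : realType) n (i : 'I_n) :
  continuous (fun u : 'rV[R]_n => u 0 i).
Proof. exact: coord_continuous. Qed.

Lemma rV_continuous (R : realType) n (T : topologicalType)
    (g : T -> 'rV[R]_n) :
  (forall i, continuous (fun x => g x 0 i)) -> continuous g.
Proof.
move=> gc x A [P Px PA].
have /filter_forall : forall i, \forall y \near x, P 0 i (g y 0 i).
  by move=> i; exact: (gc i x).
by apply: filterS => y Py; apply: PA => i j; rewrite (ord1 i).
Qed.

Lemma sum_continuous (R : realType) (T : topologicalType) (I : Type)
    (s : seq I) (P : pred I) (F : I -> T -> R) :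
  (forall i, continuous (F i)) -> continuous (fun x => \sum_(i <- s | P i) F i x).
Proof. by move=> cF; apply: continuous_big => //; exact: add_continuous. Qed.

Lemma sqn_continuous (R : realType) n : continuous (@sqn R n).
Proof.
apply: sum_continuous => i u.
apply: (@continuous_comp _ _ _ (fun v : 'rV[R]_n => v 0 i) (fun x => x ^+ 2)).
  exact: coord_cont.
exact: exprn_continuous.
Qed.

Lemma coord_le_norm (R : realType) n (u : 'rV[R]_n) i : `|u 0 i| <= `|u|.
Proof.
rewrite [leRHS]/Num.norm /= mx_normrE; apply/bigmax_geP; right => /=.
by exists (0, i).
Qed.

Lemma norm_le_coord (R : realType) n (u : 'rV[R]_n) M :
  0 <= M -> (forall i, `|u 0 i| <= M) -> `|u| <= M.
Proof.
move=> M0 uM; rewrite [leLHS]/Num.norm /= mx_normrE; apply/bigmax_leP; split=> //.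
by move=> [i j] _ /=; rewrite (ord1 i).
Qed.

(* First-order expansion of J along the step u - t G u, in the one-sided form
   and with the local uniformity in u that the deformation needs. *)
Definition descent (R : realType) (n : nat) (J : 'rV[R]_n -> R)
    (G : 'rV[R]_n -> 'rV[R]_n) : Prop :=
  forall (u0 : 'rV[R]_n) (e : R), 0 < e ->
    \forall u \near u0 & t \near (0:R)^'+,
      J (u - t *: G u) <= J u - t * sqn (G u) + t * e.

Section Critical.
Variables (R : realType) (n : nat) (J : 'rV[R]_n -> R).
Variable (G : 'rV[R]_n -> 'rV[R]_n).
Hypotheses (J_cont : continuous J) (G_cont : continuous G).
Hypothesis J_descent : descent J G.
Hypothesis J_coercive : forall a, compact [set u | J u <= a].

(** Finitely many of the neighbourhoods in [descent] cover a compact set, so one step size serves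
    all its points. *)
Lemma descent_compact (K : set 'rV[R]_n) (e : R) : compact K -> 0 < e ->
  \forall t \near (0:R)^'+,
    forall u, K u -> J (u - t *: G u) <= J u - t * sqn (G u) + t * e.
Proof.
move=> cK e0.
have := (compact_near_coveringP K).1 cK R (0:R)^'+
  (fun t u => J (u - t *: G u) <= J u - t * sqn (G u) + t * e) _.
by apply => u0 _; exact: (@J_descent u0).
Qed.

(** A descent step cannot lower [J] below its minimum, so [t * sqn (G e) <= t * d] for every [d > 0]
    and some [t > 0]. *)
Lemma minimizer_critical (e : 'rV[R]_n) : (forall u, J e <= J u) -> G e = 0.
Proof.
move=> emin; apply: sqn_eq0; apply/eqP; rewrite eq_le sqn_ge0 andbT.
apply/ler_addgt0Pr => d d0; rewrite add0r.
have := descent_compact (@compact_set1 _ e) d0.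
move=> /(filterI (nbhs_right_gt (0 : R)))/filter_ex[t [t0 /(_ e erefl)]].
move=> /(le_trans (emin _)).
rewrite -addrA lerDl -mulrN -mulrDr pmulr_rge0// addrC subr_ge0.
exact.
Qed.

Lemma exists_minimizer : exists e, forall u, J e <= J u.
Proof.
have [||c cin cmin] := @compact_EVT_min _ R J [set u | J u <= J 0] _ (@J_coercive _).
- by exists 0 => /=.
- exact: continuous_subspaceT.
exists c => u; have [u0|/ltW u0] := leP (J u) (J 0).
  by apply: cmin; rewrite inE.
by rewrite (le_trans _ u0)//; move: cin; rewrite inE.
Qed.

(** Compactness of sublevel sets plays the part of the Palais-Smale condition: the continuous
    function [h] attains its minimum there, and a zero of [h] would be a critical point at level
    [c]. *)
Lemma regular_level (c : R) : (exists u, J u <= c + 1) ->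
  (forall u, J u = c -> G u <> 0) ->
  exists2 m : R, 0 < m & forall u, J u <= c + 1 -> m <= `|J u - c| + sqn (G u).
Proof.
move=> [v vc] reg.
pose h u : R := `|J u - c| + sqn (G u).
have sGc : continuous (@sqn R n \o G).
  by move=> u; apply: continuous_comp; [exact: (@G_cont _)|exact: sqn_continuous].
have hc : continuous h.
  have Jc : continuous (fun u => J u - c).
    by move=> u; apply: continuousB; [exact: (@J_cont u)|exact: cst_continuous].
  have nJc : continuous (fun u => `|J u - c|).
    by move=> u; apply: (continuous_comp (Jc u)); exact: norm_continuous.
  by move=> u; exact: (continuousD (nJc u) (sGc u)).
have [||w win wmin] := @compact_EVT_min _ R h [set u | J u <= c + 1] _ (@J_coercive _).
- by exists v.
- exact: continuous_subspaceT.
exists (h w); last by move=> u uc; apply: wmin; rewrite inE.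
rewrite lt_neqAle addr_ge0// ?sqn_ge0// andbT eq_sym; apply/eqP => h0.
have a0 := normr_ge0 (J w - c); have b0 := sqn_ge0 (G w).
have wc : J w = c.
  by apply/eqP; rewrite -subr_eq0 -normr_eq0; apply/eqP; move: h0; rewrite /h; lra.
by apply: (reg _ wc); apply: sqn_eq0; move: h0; rewrite /h; lra.
Qed.

(* The min-max is over connected sets joining the two critical points rather
   than over paths; the descent step fixes both points and preserves
   connectedness, so it would push an almost optimal set below a regular
   level. *)
Lemma mountain_pass (r rho : R) (e : 'rV[R]_n) :
  G 0 = 0 -> G e = 0 -> 0 <= r <= `|e| ->
  (forall u, `|u| = r -> rho <= J u) ->
  exists2 u, G u = 0 & rho <= J u.
Proof.
move=> G0 Ge re barrier.
pose S := [set a : R | exists C : set 'rV[R]_n,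
  [/\ connected C, C 0, C e & forall u, C u -> J u <= a]].
have Sbarrier a : S a -> rho <= a.
  move=> [C [Cc C0 Ce Ca]].
  (* The norm maps [C] onto an interval containing [0] and [|e|], so [C] meets the sphere of radius
     [r]. *)
  have /connected_intervalP ivt : connected (@Num.norm R 'rV[R]_n @` C).
    apply: connected_continuous_connected => //.
    by apply: continuous_subspaceT => u; exact: norm_continuous.
  have I0 : (@Num.norm R 'rV[R]_n @` C) 0 by exists 0 => //; rewrite normr0.
  have Ie : (@Num.norm R 'rV[R]_n @` C) `|e| by exists e.
  have [u Cu ur] := ivt _ _ I0 Ie r re.
  exact: le_trans (barrier _ ur) (Ca _ Cu).
(* The segment from [0] to [e] is an admissible connected set. *)
have S0 : S !=set0.
  pose p (t : R) : 'rV[R]_n := t *: e.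
  have pc : continuous p by move=> t; exact: scalel_continuous.
  have Jpc : continuous (J \o p).
    by move=> t; apply: continuous_comp; [exact: pc|exact: (@J_cont _)].
  have [|t _ tmax] := @EVT_max _ (J \o p) 0 1 ler01.
    exact: continuous_subspaceT.
  exists (J (p t)), (p @` `[0, 1]); split.
  - apply: connected_continuous_connected; first exact: segment_connected.
    exact: continuous_subspaceT.
  - by exists 0; rewrite /p ?scale0r//= in_itv/= lexx ler01.
  - by exists 1; rewrite /p ?scale1r//= in_itv/= lexx ler01.
  - by move=> _ [s s01 <-]; exact: tmax.
have Sinf : has_inf S by split=> //; exists rho.
set c := inf S.
have rhoc : rho <= c by apply: lb_le_inf.
apply: contrapT => nocrit.
have reg u : J u = c -> G u <> 0 by move=> uc Gu; apply: nocrit; exists u; rewrite ?uc.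
have [a Sa ac] := inf_adherent ltr01 Sinf.
have [|m m0 mP] := @regular_level c _ reg.
  have [C [_ C0 _ Ca]] := Sa.
  by exists 0; exact: le_trans (Ca _ C0) (ltW ac).
have m4 : 0 < m / 4 by rewrite divr_gt0.
have := descent_compact (@J_coercive (c + 1)) m4.
move=> /(filterI (nbhs_right_lt (@ltr01 R)))/(filterI (nbhs_right_gt (0 : R))).
move=> /filter_ex[t [t0 [t1 tP]]].
have tm : 0 < t * m by rewrite mulr_gt0.
have tm1 : t * m <= m by rewrite ger_pMl// ltW.
(* The bound 1 keeps [C] in the sublevel set where [tP] and [mP] hold. The bound [t * m / 8] is half
   the guaranteed drop [t * m / 4] near level [c], so the deformed set ends below [c - t * m / 8],
   against the choice of [c]. *)
have eta0 : 0 < Num.min 1 (t * m / 8) by rewrite lt_min ltr01 divr_gt0.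
have [b [C [Cc C0 Ce Cb]]] := inf_adherent eta0 Sinf; rewrite -/c => bc.
have bc1 : b < c + 1 by rewrite (lt_le_trans bc)// lerD2l ge_min lexx.
have bc2 : b < c + t * m / 8 by rewrite (lt_le_trans bc)// lerD2l ge_min lexx orbT.
have /(ge_inf Sinf.2) : S (c - t * m / 8); last by rewrite -/c; lra.
pose phi (u : 'rV[R]_n) : 'rV[R]_n := u - t *: G u.
have phic : continuous phi.
  have Gc : continuous (fun u : 'rV[R]_n => t *: G u).
    by move=> u; apply: continuousZ; [exact: cst_continuous|exact: (@G_cont u)].
  move=> u; rewrite /phi.
  have ic : {for u, continuous (fun v : 'rV[R]_n => v)} by exact: cvg_id.
  exact: (continuousB ic (Gc u)).
exists (phi @` C); split.
- by apply: connected_continuous_connected => //; exact: continuous_subspaceT.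
- by exists 0 => //; rewrite /phi G0 scaler0 subr0.
- by exists e => //; rewrite /phi Ge scaler0 subr0.
- move=> _ [u Cu <-]; have uc1 : J u <= c + 1 by rewrite (le_trans (Cb _ Cu))// ltW.
  apply: (le_trans (tP _ uc1)).
  have := mP _ uc1; have := Cb _ Cu; have sG := sqn_ge0 (G u).
  (* Far from level [c], [u] lies below it, since [J u <= b] is almost [c], and the error
     [t * m / 4] cannot bring it back up. Near level [c], [sqn (G u)] exceeds [m / 2], which gives
     the drop. *)
  have [far|near] := leP (m / 2) `|J u - c|.
    have [up|dn] := leP 0 (J u - c).
      by move: far; rewrite ger0_norm//; lra.
    move: far; rewrite ltr0_norm// => far _ _.
    have : 0 <= t * sqn (G u) by rewrite mulr_ge0// ltW.
    lra.
  move=> Jb mG.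
  have : t * (m / 2) <= t * sqn (G u) by rewrite ler_pM2l//; lra.
  lra.
Qed.
End Critical.

(** * The oriented integral *)

Lemma continuous_itv_integrable (R : realType) (f : R -> R) (a b : R) :
  continuous f -> (@lebesgue_measure R).-integrable `[a, b] (EFin \o f).
Proof.
move=> fc; apply: continuous_compact_integrable; first exact: segment_compact.
exact: continuous_subspaceT.
Qed.

(** A base point [a] to the left of both [0] and [y] removes the case split on the sign of [y], so
    that the fundamental theorem of calculus applies across [0]. *)
Lemma int0E (R : realType) (f : R -> R) (a y : R) : continuous f ->
  a <= 0 -> a <= y ->
  int0 f y = \int[@lebesgue_measure R]_(s in `[a, y]) f s
           - \int[@lebesgue_measure R]_(s in `[a, 0]) f s.
Proof.
move=> fc a0 ay.
have oc (b c : R) : \int[@lebesgue_measure R]_(s in `]b, c]) f s =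
    \int[@lebesgue_measure R]_(s in `[b, c]) f s.
  apply: Rintegral_itv_obnd_cbnd.
  have := @continuous_itv_integrable R f b c fc; apply: integrableS => //.
  by apply: subset_itvr; rewrite bnd_simp.
rewrite /int0; case: ifPn => [y0|]; last rewrite -ltNge => /ltW y0.
  rewrite Rintegral_itvB ?bnd_simp// ?oc//.
  exact: continuous_itv_integrable.
rewrite -(oc y 0) -(@Rintegral_itvB _ _ (BLeft a)) ?bnd_simp//.
  by rewrite opprB.
exact: continuous_itv_integrable.
Qed.

Lemma is_derive_int0 (R : realType) (f : R -> R) (x : R) :
  continuous f -> is_derive x 1 (int0 f) (f x).
Proof.
move=> fc.
pose a := Num.min x 0 - 1.
have a0 : a < 0 by rewrite /a ltrBlDr add0r gt_min ltr01 orbT.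
have ax : a < x by rewrite /a ltrBlDr gt_min ltrDl ltr01.
pose H y := \int[@lebesgue_measure R]_(s in `[a, y]) f s.
have [] := @continuous_FTC1 R f (BLeft a) x (x + 1) _ _ _ (fc x).
- by rewrite ltrDl.
- exact: continuous_itv_integrable.
- exact: ax.
rewrite -/H => Hd; rewrite derive1E => HE.
have Hx : is_derive x 1 (fun y => H y - H 0) (f x).
  have -> : f x = f x - 0 by rewrite subr0.
  by apply: is_deriveB; exact: DeriveDef.
have E : \forall y \near x, H y - H 0 = int0 f y.
  near=> y; apply/esym/int0E => //; first exact: ltW.
  by apply/ltW; near: y; exact: lt_nbhsr.
exact: near_eq_is_derive E Hx.
Unshelve. all: by end_near. Qed.

Lemma int0_MVT (R : realType) (f : R -> R) (a b : R) : continuous f ->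
  exists2 c, Num.min a b <= c <= Num.max a b &
    int0 f b - int0 f a = f c * (b - a).
Proof.
move=> fc; wlog ab : a b / a <= b => [H|].
  have /orP[ab|ba] := le_total a b; first exact: H.
  have [c cab E] := H _ _ ba; exists c; first by rewrite minC maxC.
  by rewrite -opprB E -mulrN opprB.
have [x _||c cab E] := @MVT_segment R (int0 f) f a b ab.
- exact: is_derive_int0.
- apply: continuous_subspaceT => x.
  apply/differentiable_continuous/derivable1_diffP.
  exact: (@ex_derive _ _ _ _ _ _ _ (is_derive_int0 x fc)).
by exists c => //; rewrite min_l// max_r//; move: cab; rewrite in_itv.
Qed.

(** * The fourth-difference operator *)

(* Zero extension shifted by one: pad u j is the paper's u_(j-1), so that the
   indices stay in nat down to the boundary point -1. *)
Definition pad (R : realType) (n : nat) (u : 'rV[R]_n) (j : nat) : R :=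
  \sum_(i < n | j == i.+2) u 0 i.

Definition lap (R : realType) (a : nat -> R) (j : nat) : R :=
  a j.+2 - 2 * a j.+1 + a j.

(** [lap (pad u) j] is the second difference centred at $u_j$, so coordinate [i] holds the fourth
    difference centred at $u_{i+1}$. *)
Definition beam_op (R : realType) (n : nat) (u : 'rV[R]_n) : 'rV[R]_n :=
  \row_i lap (lap (pad u)) i.

(** The centres $0,\dots,n+1$ are exactly those whose second difference can be nonzero for a vector
    extended by zero. *)
Definition beam_form (R : realType) (n : nat) (u v : 'rV[R]_n) : R :=
  \sum_(j < n.+2) lap (pad u) j * lap (pad v) j.

Section Beam.
Variables (R : realType) (n : nat).
Implicit Types u v : 'rV[R]_n.

Lemma pad_ord u (i : 'I_n) : pad u i.+2 = u 0 i.
Proof.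
by rewrite /pad (eq_bigl (eq_op^~ i)) ?big_pred1_eq// => j; rewrite !eqSS eq_sym.
Qed.

Lemma pad_out u j : (j < 2)%N || (n.+2 <= j)%N -> pad u j = 0.
Proof.
move=> jout; rewrite /pad big_pred0// => i; apply/eqP => jE.
by move: jout; rewrite jE /= !ltnS leqNgt ltn_ord.
Qed.

Lemma padB u v (t : R) j : pad (u - t *: v) j = pad u j - t * pad v j.
Proof.
by rewrite /pad mulr_sumr -sumrB; apply: eq_bigr => i _; rewrite !mxE.
Qed.

Lemma pad_continuous j : continuous (fun u => pad u j).
Proof. by apply: sum_continuous => i; exact: coord_cont. Qed.

Lemma lap_continuous (a : 'rV[R]_n -> nat -> R) j :
  (forall j, continuous (a^~ j)) -> continuous (fun u => lap (a u) j).
Proof.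
move=> ac u.
have c2 : {for u, continuous (fun v => 2 * a v j.+1)}.
  exact: (continuousM (@cst_continuous _ _ (2 : R) u) (ac j.+1 u)).
exact: (continuousD (continuousB (ac j.+2 u) c2) (ac j u)).
Qed.

Lemma beam_op_continuous i : continuous (fun u => beam_op u 0 i).
Proof.
have -> : (fun u => beam_op u 0 i) = (fun u => lap (lap (pad u)) i).
  by apply/funext => u; rewrite mxE.
by do 2 (apply: lap_continuous => ?); exact: pad_continuous.
Qed.

Lemma beam_form_continuous : continuous (fun u => beam_form u u).
Proof.
apply: sum_continuous => j u.
have lc : continuous (fun v => lap (@pad R n v) j).
  by apply: lap_continuous => ?; exact: pad_continuous.
exact: (continuousM (lc u) (lc u)).
Qed.

(** Discrete Green identity: the difference of the two sums telescopes along [T], which vanishes at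
    both ends by the boundary values of [c]. *)
Lemma lap_by_parts (w c : nat -> R) N :
  c 0 = 0 -> c 1 = 0 -> c N = 0 -> c N.+1 = 0 ->
  \sum_(j < N) c j.+2 * lap w j = \sum_(j < N) w j * lap c j.
Proof.
move=> c0 c1 cN cN1; apply/eqP; rewrite -subr_eq0 -sumrB; apply/eqP.
pose T j := c j * w j + c j.+1 * w j.+1 - 2 * c j.+1 * w j.
rewrite (eq_bigr (fun j : 'I_N => T j.+1 - T j)); last first.
  by move=> j _; rewrite /T /lap; ring.
rewrite -(big_mkord xpredT (fun j => T j.+1 - T j)) telescope_sumr//.
by rewrite /T c0 c1 cN cN1; ring.
Qed.

Lemma beam_formE u v : \sum_(i < n) v 0 i * beam_op u 0 i = beam_form u v.
Proof.
rewrite /beam_form -(lap_by_parts (lap (pad u))) ?pad_out// ?leqnn ?leqnSn ?orbT//.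
(* The last two of the [n.+2] terms carry the factors [pad v n.+2] and [pad v n.+3], which are
   zero. *)
rewrite !big_ord_recr/= !pad_out ?leqnn ?leqnSn ?orbT// !mul0r !addr0.
by apply: eq_bigr => i _; rewrite pad_ord mxE.
Qed.

Lemma beam_formB u v (t : R) :
  beam_form (u - t *: v) (u - t *: v) =
  beam_form u u - 2 * t * beam_form u v + t ^+ 2 * beam_form v v.
Proof.
rewrite /beam_form !mulr_sumr -sumrB -big_split/=; apply: eq_bigr => j _.
by rewrite /lap !padB; ring.
Qed.

(** Each second difference is at most the root [s] of the form. Summing twice from the zero boundary
    values bounds first differences by [j * s] and values by [j ^ 2 * s], a discrete Poincaré
    inequality. *)
Lemma beam_form_coercive :
  exists2 q : R, 0 < q & forall u, q * sqn u <= beam_form u u.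
Proof.
pose K : R := (n.+2 ^ 2)%:R ^+ 2.
exists (n%:R * K + 1)^-1; first by rewrite invr_gt0 ltr_wpDl// mulr_ge0// sqr_ge0.
move=> u; rewrite mulrC ler_pdivrMr ?ltr_wpDl ?mulr_ge0 ?sqr_ge0//.
have Q0 : 0 <= beam_form u u.
  by apply: sumr_ge0 => j _; rewrite -expr2 sqr_ge0.
pose s := Num.sqrt (beam_form u u).
have s0 : 0 <= s by exact: sqrtr_ge0.
have s2 : s ^+ 2 = beam_form u u by exact: sqr_sqrtr.
have laps j : (j < n.+2)%N -> `|lap (pad u) j| <= s.
  move=> jn; rewrite -(ler_pXn2r (n := 2)) ?nnegrE// s2 real_normK ?num_real//.
  rewrite /beam_form (bigD1 (Ordinal jn))//= -expr2 lerDl.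
  by apply: sumr_ge0 => k _; rewrite -expr2 sqr_ge0.
have bnd j : (j <= n.+2)%N -> `|pad u j.+1 - pad u j| <= j%:R * s /\
    `|pad u j| <= (j ^ 2)%:R * s.
  elim: j => [|j IH] jn; first by rewrite !pad_out// subr0 normr0 !mul0r.
  have [IH1 IH2] := IH (ltnW jn); have lj := laps _ jn; split.
    have -> : pad u j.+2 - pad u j.+1 = (pad u j.+1 - pad u j) + lap (pad u) j.
      by rewrite /lap; ring.
    rewrite (le_trans (ler_normD _ _))// (le_trans (lerD IH1 lj))//.
    by rewrite -natr1 mulrDl mul1r.
  have -> : pad u j.+1 = (pad u j.+1 - pad u j) + pad u j by ring.
  rewrite (le_trans (ler_normD _ _))// (le_trans (lerD IH1 IH2))//.
  by rewrite -mulrDl ler_wpM2r// -natrD ler_nat; nia.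
have coord (i : 'I_n) : u 0 i ^+ 2 <= K * beam_form u u.
  have [|_] := bnd i.+2; first by rewrite !ltnS ltnW.
  rewrite pad_ord => ui; rewrite -s2 /K -exprMn -[leLHS]real_normK ?num_real//.
  rewrite ler_pXn2r ?nnegrE ?mulr_ge0//; apply: (le_trans ui).
  by rewrite ler_wpM2r// ler_nat leq_exp2r// !ltnS ltnW.
have : sqn u <= n%:R * (K * beam_form u u).
  have -> : n%:R * (K * beam_form u u) = \sum_(i < n) K * beam_form u u.
    by rewrite sumr_const card_ord mulr_natl.
  exact: ler_sum.
by move=> /le_trans; apply; rewrite mulrDr mulr1 mulrA mulrC lerDl.
Qed.

Lemma beam_solution (f : 'I_n -> R -> R) (lambda : R) u :
  (forall i, beam_op u 0 i = lambda * f i (u 0 i)) -> is_solution f lambda u.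
Proof.
(* [x] extends [u] by zero to all integers; [xpad] transfers the facts about [pad]. *)
move=> uE; pose x (k : int) := \sum_(i < n | k == i.+1%:Z) u 0 i.
have xpad (j : nat) : x (j%:Z - 1) = pad u j.
  by rewrite /x /pad; apply: eq_bigl => i; rewrite subr_eq -PoszD addn1.
have xi (i : 'I_n) : x i.+1%:Z = u 0 i.
  by rewrite -pad_ord -xpad; congr x; lia.
exists x => //; split; last 2 first.
- split.
  (* The point $-2$ lies to the left of the range of [pad], so the empty sum is computed
     directly. *)
  + by rewrite /x big_pred0// => i; lia.
  + by rewrite (_ : - 1%:Z = 0%N%:Z - 1) ?xpad ?pad_out//; lia.
  + by rewrite -[x 0]/(x (1%N%:Z - 1)) xpad pad_out.
- split.
  + rewrite (_ : n.+1%:Z = n.+2%:Z - 1); last lia.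
    by rewrite xpad pad_out//; lia.
  + rewrite (_ : n.+2%:Z = n.+3%:Z - 1); last lia.
    by rewrite xpad pad_out//; lia.
  + rewrite (_ : n.+3%:Z = n.+4%:Z - 1); last lia.
    by rewrite xpad pad_out//; lia.
move=> i; rewrite xi -uE mxE /= /fdiff /lap -!xpad.
have -> : i.+1%:Z - 2 = i%:Z - 1 by lia.
have S (j : nat) : j.+1%:Z - 1 = j%:Z - 1 + 1 by lia.
by rewrite !S; ring.
Qed.
End Beam.

(** * The energy functional *)

Section Energy.
Variables (R : realType) (n : nat) (f : 'I_n -> R -> R) (lambda : R).
Hypothesis f_cont : forall k, continuous (f k).

Definition energy (u : 'rV[R]_n) : R :=
  beam_form u u / 2 - lambda * \sum_(k < n) int0 (f k) (u 0 k).

Definition energy_grad (u : 'rV[R]_n) : 'rV[R]_n :=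
  \row_k (beam_op u 0 k - lambda * f k (u 0 k)).

Lemma int0_continuous (k : 'I_n) : continuous (int0 (f k)).
Proof.
move=> x; apply/differentiable_continuous/derivable1_diffP.
exact: (@ex_derive _ _ _ _ _ _ _ (is_derive_int0 x (@f_cont k))).
Qed.

Lemma energy_continuous : continuous energy.
Proof.
have Fc : continuous (fun u : 'rV[R]_n => \sum_(k < n) int0 (f k) (u 0 k)).
  apply: sum_continuous => k u.
  by apply: continuous_comp; [exact: coord_cont|exact: int0_continuous].
have Bc := @beam_form_continuous R n.
move=> u; have c1 := continuousM (Bc u) (@cst_continuous _ _ (2^-1 : R) u).
have c2 := continuousM (@cst_continuous _ _ lambda u) (Fc u).
exact: (continuousB c1 c2).
Qed.

Lemma energy_grad_coord_continuous k : continuous (fun u => energy_grad u 0 k).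
Proof.
have fc : continuous (fun u : 'rV[R]_n => f k (u 0 k)).
  by move=> u; apply: continuous_comp; [exact: coord_cont|exact: f_cont].
have -> : (fun u => energy_grad u 0 k) =
    (fun u => beam_op u 0 k - lambda * f k (u 0 k)).
  by apply/funext => u; rewrite mxE.
move=> u; have c2 := continuousM (@cst_continuous _ _ lambda u) (fc u).
exact: (continuousB (@beam_op_continuous R n k u) c2).
Qed.

Lemma energy_grad_continuous : continuous energy_grad.
Proof. by apply: rV_continuous => k; exact: energy_grad_coord_continuous. Qed.

(** By the mean value theorem the increment is [f k c * (t * g x)] with [c] between the endpoints;
    continuity of [f k] at [h x0] makes [f k c] close to [f k (h x)], uniformly near [x0]. *)
Lemma int0_descent (T : topologicalType) (g h : T -> R) (k : 'I_n) (x0 : T)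
    (e : R) :
  {for x0, continuous g} -> {for x0, continuous h} -> 0 < e ->
  \forall x \near x0 & t \near (0 : R)^'+,
    lambda * (int0 (f k) (h x) - int0 (f k) (h x - t * g x)) <=
    t * (lambda * (g x * f k (h x)) + e).
Proof.
move=> gc hc e0.
(* [M] bounds [|g|] near [x0], and [d] is the tolerance on [f k] that keeps the total error below
   [e]. *)
pose M : R := `|g x0| + 1; pose d := e / ((`|lambda| + 1) * M).
have M0 : 0 < M by rewrite ltr_wpDl.
have l0 : 0 < `|lambda| + 1 by rewrite ltr_wpDl.
have d0 : 0 < d by rewrite divr_gt0// mulr_gt0.
have d2 : 0 < d / 2 by rewrite divr_gt0.
have := @f_cont k (h x0); move/cvgr_dist_lt => /(_ _ d2)/nbhs_ballP[r /= r0 rP].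
have r2 : 0 < r / 2 by rewrite divr_gt0.
move/cvgr_dist_lt : gc => /(_ _ ltr01) gc1.
move/cvgr_dist_lt : hc => /(_ _ r2) hcr.
near=> x t.
have t0 : 0 < t by near: t; exact: nbhs_right_gt.
have tr : t * M < r / 2.
  by rewrite -ltr_pdivlMr//; near: t; apply: nbhs_right_lt; rewrite divr_gt0.
have gM : `|g x| <= M.
  have : `|g x0 - g x| < 1 by near: x; exact: gc1.
  by move: (lerB_dist (g x) (g x0)); rewrite distrC /M; lra.
have hr : `|h x0 - h x| < r / 2 by near: x; exact: hcr.
have tg : `|t * g x| < r / 2.
  by rewrite normrM gtr0_norm// (le_lt_trans _ tr)// ler_pM2l.
have [c cP E] := int0_MVT (h x - t * g x) (h x) (@f_cont k).
have cr : `|h x0 - c| < r.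
  move: cP hr tg; rewrite !ltr_norml => + /andP[h1 h2] /andP[h3 h4].
  have [_|_] := leP (h x - t * g x) (h x); move=> /andP[h5 h6]; apply/andP; lra.
have hr' : `|h x0 - h x| < r by rewrite (lt_trans hr)// ltr_pdivrMr// ltr_pMr// ltr1n.
have fd : `|f k c - f k (h x)| <= d.
  have fc := rP c cr; have fh := rP (h x) hr'.
  rewrite (_ : _ - _ = (f k (h x0) - f k (h x)) - (f k (h x0) - f k c)); last by ring.
  by rewrite (le_trans (ler_normB _ _))//; rewrite /= in fc fh; lra.
rewrite E opprB addrC subrK mulrCA -subr_ge0.
have -> : t * (lambda * (g x * f k (h x)) + e) - f k c * (lambda * (t * g x)) =
  t * (e - lambda * g x * (f k c - f k (h x))) by ring.
rewrite mulr_ge0 ?(ltW t0)// subr_ge0 (le_trans (ler_norm _))// !normrM.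
have -> : e = (`|lambda| + 1) * M * d.
  by rewrite /d mulrC divfK// mulf_neq0 ?gt_eqF.
by rewrite ler_pM ?mulr_ge0// ler_pM// lerDl.
Unshelve. all: by end_near. Qed.

(** The quadratic part expands exactly, with a remainder of order [t ^+ 2]; the integrals are
    handled coordinatewise by [int0_descent]. The first-order terms add up to [- t * sqn G]. *)
Lemma energy_descent : descent energy energy_grad.
Proof.
move=> u0 e e0.
(* One share of the error for each of the [n] coordinates, and one for the quadratic remainder. *)
pose e' := e / (n.+1)%:R.
have e'0 : 0 < e' by rewrite divr_gt0.
pose P (k : 'I_n) (u : 'rV[R]_n) (t : R) :=
    lambda * (int0 (f k) (u 0 k) - int0 (f k) (u 0 k - t * energy_grad u 0 k))
    <= t * (lambda * (energy_grad u 0 k * f k (u 0 k)) + e').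
have parts : \forall u \near u0 & t \near (0 : R)^'+, forall k, P k u t.
  apply: (@filter_forall _ _ (fun k x => P k x.1 x.2)
    (filter_prod (nbhs u0) (nbhs (0 : R)^'+))) => k.
  exact: (@int0_descent _ (fun u => energy_grad u 0 k) (fun u => u 0 k) k u0 e'
    (@energy_grad_coord_continuous k u0) (@coord_cont R n k u0) e'0).
have Qc : continuous (fun u => beam_form (energy_grad u) (energy_grad u)).
  move=> u; apply: (@continuous_comp _ _ _ energy_grad (fun v => beam_form v v)).
    exact: energy_grad_continuous.
  exact: beam_form_continuous.
pose M : R := `|beam_form (energy_grad u0) (energy_grad u0)| + 1.
have M0 : 0 < M by rewrite ltr_wpDl.
have Qc1 := Qc u0; move/cvgr_dist_lt : Qc1 => /(_ _ ltr01) Qc1.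
pose P' (u : 'rV[R]_n) (t : R) := 0 < t /\
    t / 2 * beam_form (energy_grad u) (energy_grad u) <= e'.
have quad : \forall u \near u0 & t \near (0 : R)^'+, P' u t.
  near=> u t.
  have t0 : 0 < t by near: t; exact: nbhs_right_gt.
  have tM : t * M < e'.
    by rewrite -ltr_pdivlMr//; near: t; apply: nbhs_right_lt; rewrite divr_gt0.
  split=> //.
  have QM : beam_form (energy_grad u) (energy_grad u) <= M.
    have : `|beam_form (energy_grad u0) (energy_grad u0) -
        beam_form (energy_grad u) (energy_grad u)| < 1.
      by near: u; exact: Qc1.
    rewrite ltr_norml => /andP[+ _].
    by have := ler_norm (beam_form (energy_grad u0) (energy_grad u0)); rewrite /M; lra.
  have : t * beam_form (energy_grad u) (energy_grad u) <= t * M by rewrite ler_pM2l.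
  have : 0 < t * M by rewrite mulr_gt0.
  rewrite /=; lra.
apply: filterS2 parts quad => -[u t] /= uP [t0 Q].
rewrite /P in uP; set G := energy_grad u in uP Q *.
have {}uP : lambda * (\sum_k int0 (f k) (u 0 k)
      - \sum_k int0 (f k) ((u - t *: G) 0 k))
    <= t * (lambda * (\sum_k G 0 k * f k (u 0 k)) + n%:R * e').
  rewrite -sumrB mulr_sumr mulrDr mulr_sumr mulr_sumr.
  have -> : t * (n%:R * e') = \sum_(k < n) t * e'.
    by rewrite sumr_const card_ord -mulr_natl; ring.
  rewrite -big_split/=; apply: ler_sum => k _.
  have -> : (u - t *: G) 0 k = u 0 k - t * G 0 k by rewrite !mxE.
  by rewrite -mulrDr; exact: uP.
have sG : sqn G = beam_form u G - lambda * \sum_k G 0 k * f k (u 0 k).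
  rewrite -beam_formE mulr_sumr -sumrB; apply: eq_bigr => k _.
  have -> : G 0 k ^+ 2 = G 0 k * (beam_op u 0 k - lambda * f k (u 0 k)).
    by rewrite expr2 [in X in _ * X = _]/G mxE.
  ring.
have -> : e = n%:R * e' + e' by rewrite -[X in _ + X]mul1r -mulrDl natr1 mulrC divfK.
rewrite /energy beam_formB sG.
have : t * (t / 2 * beam_form G G) <= t * e' by rewrite ler_pM2l.
move: uP; rewrite expr2; lra.
Unshelve. all: by end_near. Qed.
End Energy.

(** * Growth of the nonlinearity *)

(** The limits at infinity give [e * |s|] outside some [[-M, M]]; [C] is the maximum of [|f|] on
    that segment. *)
Lemma sublinear_bound (R : realType) (f : R -> R) (e : R) : continuous f ->
  f s / s @[s --> +oo] --> (0 : R) -> f s / s @[s --> -oo] --> (0 : R) ->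
  0 < e -> exists2 C : R, 0 <= C & forall s, `|f s| <= e * `|s| + C.
Proof.
move=> fc fp fm e0.
have small (s : R) : s != 0 -> `|f s / s| < e -> `|f s| <= e * `|s|.
  by move=> s0; rewrite normrM normfV ltr_pdivrMr ?normr_gt0// => /ltW.
have [M1 [_ M1P]] : \forall s \near +oo, `|f s / s| < e.
  by move/cvgr_dist_lt : fp => /(_ _ e0); apply: filterS => s; rewrite sub0r normrN.
have [M2 [_ M2P]] : \forall s \near -oo, `|f s / s| < e.
  by move/cvgr_dist_lt : fm => /(_ _ e0); apply: filterS => s; rewrite sub0r normrN.
pose M := `|M1| + `|M2| + 1.
have M0 : 0 < M by rewrite ltr_wpDl// addr_ge0.
have M1M : M1 < M by have := ler_norm M1; have := normr_ge0 M2; rewrite /M; lra.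
have M2M : - M < M2.
  by have := ler_norm (- M2); rewrite normrN; have := normr_ge0 M1; rewrite /M; lra.
have [||c _ cmax] := @EVT_max _ (fun s => `|f s|) (- M) M.
- lra.
- apply: continuous_subspaceT => s; apply: (continuous_comp (fc s)).
  exact: norm_continuous.
exists `|f c| => // s.
have [sM|Ms] := leP s M; last first.
  rewrite ler_wpDr//; apply: small; first by rewrite gt_eqF// (lt_trans M0).
  exact/M1P/(lt_trans M1M).
have [Ms|sM2] := leP (- M) s.
  by rewrite ler_wpDl ?mulr_ge0 ?(ltW e0)// cmax// in_itv/= Ms.
rewrite ler_wpDr//; apply: small; first by rewrite lt_eqF// (lt_trans sM2)// oppr_lt0.
exact/M2P/(lt_trans sM2).
Qed.

Lemma superlinear_zero (R : realType) (f : R -> R) (e : R) : continuous f ->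
  f s / s @[s --> (0 : R)^'] --> (0 : R) -> 0 < e ->
  f 0 = 0 /\ \forall r \near (0 : R)^'+, forall s, `|s| <= r -> `|f s| <= e * `|s|.
Proof.
move=> fc f0 e0.
(* Near [0], [f s] is the product of [f s / s] and [s], which both tend to [0]; continuity then
   fixes the value at [0]. *)
have fz : f 0 = 0.
  have c1 : f s @[s --> (0 : R)^'] --> f 0 by apply/continuous_withinNx; exact: fc.
  have c2 : f s / s * s @[s --> (0 : R)^'] --> (0 * 0 : R).
    by apply: cvgM => //; exact: cvg_within.
  have c3 : f s @[s --> (0 : R)^'] --> (0 : R).
    rewrite mulr0 in c2; apply: cvg_trans c2; apply: near_eq_cvg.
    by near=> s; rewrite divfK//; near: s; exact: nbhs_dnbhs_neq.
  exact: (cvg_unique _ c1 c3).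
split=> //.
have [r /= r0 rP] : \forall s \near (0 : R)^', `|f s / s| < e.
  by move/cvgr_dist_lt : f0 => /(_ _ e0); apply: filterS => s; rewrite sub0r normrN.
near=> t; move=> s st; have [->|s0] := eqVneq s 0; first by rewrite fz !normr0 mulr0.
have := rP s; rewrite /ball_ /= sub0r normrN => /(_ _ s0).
rewrite normrM normfV ltr_pdivrMr ?normr_gt0// => H; apply/ltW/H.
by apply: (le_lt_trans st); near: t; exact: nbhs_right_lt.
Unshelve. all: by end_near. Qed.

Lemma int0_0 (R : realType) (f : R -> R) : int0 f 0 = 0.
Proof. by rewrite /int0 lexx set_itv1 Rintegral_set1. Qed.

Lemma int0_bound (R : realType) (f : R -> R) (x B : R) : continuous f ->
  (forall s, `|s| <= `|x| -> `|f s| <= B) -> `|int0 f x| <= B * `|x|.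
Proof.
move=> fc fB; have [c cx E] := int0_MVT 0 x fc.
rewrite int0_0 !subr0 in E; rewrite E normrM ler_wpM2r// fB//.
move: cx; rewrite ler_norml; have [x0|x0] := leP 0 x.
  by rewrite ger0_norm// => /andP[c0 ->]; rewrite andbT; lra.
by rewrite ltr0_norm// opprK => /andP[->]/=; lra.
Qed.

Lemma affine_le_quadratic (R : realType) (L C e : R) : 0 <= L -> 0 < e ->
  exists2 K : R, 0 <= K &
    forall x, 0 <= x -> L * x * (e / (2 * (L + 1)) * x + C) <= e * x ^+ 2 + K.
Proof.
(* The quadratic term uses at most [e / 2 * x ^+ 2]; completing the square absorbs [L * C * x] into
   the other half, at the cost of this constant. *)
move=> L0 e0; exists ((L * C) ^+ 2 / (2 * e)).
  by rewrite divr_ge0 ?sqr_ge0// mulr_ge0// ltW.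
move=> x x0.
have -> : L * x * (e / (2 * (L + 1)) * x + C) =
    L / (L + 1) * (e / 2 * x ^+ 2) + L * C * x by field; lra.
have L1 : L / (L + 1) * (e / 2 * x ^+ 2) <= e / 2 * x ^+ 2.
  rewrite ler_piMl ?mulr_ge0 ?sqr_ge0 ?divr_ge0 ?(ltW e0)//.
  by rewrite ler_pdivrMr; lra.
have : 0 <= (e * x - L * C) ^+ 2 / (2 * e).
  by rewrite divr_ge0 ?sqr_ge0// mulr_ge0// ltW.
have -> : (e * x - L * C) ^+ 2 / (2 * e) =
    e / 2 * x ^+ 2 - L * C * x + (L * C) ^+ 2 / (2 * e) by field; lra.
lra.
Qed.

(** * Critical points of the energy *)

Lemma norm_le_sqn (R : realType) n (u : 'rV[R]_n) : `|u| ^+ 2 <= sqn u.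
Proof.
have s0 := sqrtr_ge0 (sqn u).
rewrite -[leRHS]sqr_sqrtr ?sqn_ge0// ler_pXn2r ?nnegrE//.
by apply: norm_le_coord => // i; rewrite -sqrtr_sqr ler_wsqrtr ?sqn_coord.
Qed.

(** The first estimate serves the a priori bound on critical points, the second the coercivity of
    the energy. *)
Lemma nonlinearity_growth (R : realType) (f : R -> R) (L e : R) : continuous f ->
  f s / s @[s --> +oo] --> (0 : R) -> f s / s @[s --> -oo] --> (0 : R) ->
  0 <= L -> 0 < e -> exists2 K : R, 0 <= K & forall x,
    L * (`|x| * `|f x|) <= e * x ^+ 2 + K /\ L * `|int0 f x| <= e * x ^+ 2 + K.
Proof.
move=> fc fp fm L0 e0; set d := e / (2 * (L + 1)).
have d0 : 0 < d by rewrite divr_gt0//; lra.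
have [C C0 fC] := sublinear_bound fc fp fm d0.
have [K K0 KP] := affine_le_quadratic C L0 e0.
exists K => // x; have := KP _ (normr_ge0 x); rewrite -/d real_normK ?num_real//.
move=> Kx; split; apply: le_trans Kx; rewrite -mulrA ler_wpM2l//.
  by rewrite ler_wpM2l.
rewrite [leRHS]mulrC; apply: int0_bound => // s sx; apply: (le_trans (fC s)).
by rewrite lerD2r ler_pM2l.
Qed.

Section Problem.
Variables (R : realType) (n : nat) (f : 'I_n -> R -> R).
Hypothesis f_cont : forall k, continuous (f k).
Hypothesis f_pinfty : forall k, f k s / s @[s --> +oo] --> (0 : R).
Hypothesis f_ninfty : forall k, f k s / s @[s --> -oo] --> (0 : R).
Hypothesis f_zero : forall k, f k s / s @[s --> (0 : R)^'] --> (0 : R).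

Lemma sum_growth (L e : R) : 0 <= L -> 0 < e ->
  exists S : R, forall u : 'rV[R]_n,
    L * (\sum_k `|u 0 k| * `|f k (u 0 k)|) <= e * sqn u + S /\
    L * (\sum_k `|int0 (f k) (u 0 k)|) <= e * sqn u + S.
Proof.
move=> L0 e0.
have /choice[K KP] (k : 'I_n) : exists K : R, forall x,
    L * (`|x| * `|f k x|) <= e * x ^+ 2 + K /\
    L * `|int0 (f k) x| <= e * x ^+ 2 + K.
  have [K _ KP] := nonlinearity_growth (@f_cont k) (@f_pinfty k) (@f_ninfty k) L0 e0.
  by exists K.
exists (\sum_k K k) => u; rewrite !mulr_sumr -big_split/=.
by split; apply: ler_sum => k _; have [] := KP k (u 0 k).
Qed.

(** The integrals cost at most [q / 4 * sqn u + S] out of the [q / 2 * sqn u] given by the form, so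
    sublevel sets are bounded as well as closed. *)
Lemma energy_coercive (lambda a : R) : 0 <= lambda ->
  compact [set u : 'rV[R]_n | energy f lambda u <= a].
Proof.
move=> l0; have [q q0 qP] := beam_form_coercive R n.
have q4 : 0 < q / 4 by rewrite divr_gt0.
have [S SP] := sum_growth l0 q4.
apply: bounded_closed_compact; last first.
  apply: ((continuous_closedP (energy f lambda)).1 _ _ (@closed_le R a)).
  by apply: energy_continuous => k; exact: (@f_cont k).
exists (4 * (a + S) / q + 1); split; first exact: num_real.
move=> M TM u /= ua; apply: le_trans (ltW TM).
have uT : sqn u <= 4 * (a + S) / q.
  rewrite ler_pdivlMr//.
  have Fu : lambda * (\sum_k int0 (f k) (u 0 k)) <= q / 4 * sqn u + S.
    apply: le_trans (SP u).2; rewrite ler_wpM2l// ler_sum// => k _.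
    exact: ler_norm.
  by move: ua; rewrite /energy; have := qP u; lra.
have := norm_le_sqn u; have := sqr_ge0 (`|u| - 1); rewrite sqrrB1.
by have := normr_ge0 u; lra.
Qed.

Lemma energy_barrier (lambda : R) : 0 <= lambda ->
  exists2 q : R, 0 < q & \forall r \near (0 : R)^'+,
    forall u : 'rV[R]_n, `|u| <= r -> q * sqn u <= energy f lambda u.
Proof.
move=> l0; have [q q0 qP] := beam_form_coercive R n.
exists (q / 4); first by rewrite divr_gt0.
(* Chosen so that [lambda * e <= q / 4]: the integrals then use at most half of the quadratic lower
   bound. *)
pose e := q / (4 * (lambda + 1)).
have e0 : 0 < e by rewrite divr_gt0//; lra.
have le : lambda * e <= q / 4.
  have -> : lambda * e = lambda / (lambda + 1) * (q / 4) by rewrite /e; field; lra.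
  by rewrite ler_piMl ?divr_ge0 ?(ltW q0)// ler_pdivrMr; lra.
have near_f : \forall r \near (0 : R)^'+, forall k : 'I_n, forall s,
    `|s| <= r -> `|f k s| <= e * `|s|.
  apply: filter_forall => k.
  exact: (superlinear_zero (@f_cont k) (@f_zero k) e0).2.
apply: filterS near_f => r rP u ur.
have Fu : lambda * (\sum_k int0 (f k) (u 0 k)) <= q / 4 * sqn u.
  apply: (@le_trans _ _ (lambda * (e * sqn u))); last first.
    by rewrite mulrA ler_wpM2r ?sqn_ge0.
  rewrite ler_wpM2l// /sqn mulr_sumr ler_sum// => k _.
  apply: (le_trans (ler_norm _)).
  rewrite -[u 0 k ^+ 2]real_normK ?num_real// expr2 mulrA.
  apply: int0_bound => [|s su]; first exact: (@f_cont k).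
  apply: (@le_trans _ _ (e * `|s|)); last by rewrite ler_pM2l.
  by apply: rP; rewrite (le_trans su)// (le_trans (coord_le_norm u k)).
by rewrite /energy; have := qP u; lra.
Qed.

Lemma critical_coord (lambda : R) (u : 'rV[R]_n) k :
  energy_grad f lambda u = 0 -> beam_op u 0 k = lambda * f k (u 0 k).
Proof. by move/rowP/(_ k); rewrite !mxE => /eqP; rewrite subr_eq0 => /eqP. Qed.

(** Pairing the critical point equation with [u] bounds the form by [L * \sum_k |u_k| |f_k(u_k)|],
    hence by [q / 2 * sqn u + S]; coercivity absorbs the first term, and only [L] enters the
    constants. *)
Lemma critical_bounded (L : R) : 0 <= L -> exists M : R,
  forall (lambda : R) (u : 'rV[R]_n), 0 <= lambda <= L ->
    energy_grad f lambda u = 0 -> sqn u <= M.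
Proof.
move=> L0; have [q q0 qP] := beam_form_coercive R n.
have q2 : 0 < q / 2 by rewrite divr_gt0.
have [S SP] := sum_growth L0 q2.
exists (2 * S / q) => lambda u /andP[l0 lL] Gu.
have Q : beam_form u u <= L * (\sum_k `|u 0 k| * `|f k (u 0 k)|).
  rewrite -beam_formE mulr_sumr ler_sum// => k _.
  rewrite (critical_coord k Gu) mulrCA -normrM.
  apply: (@le_trans _ _ (lambda * `|u 0 k * f k (u 0 k)|)).
    by rewrite ler_wpM2l// ler_norm.
  by rewrite ler_wpM2r.
rewrite ler_pdivlMr//; have := qP u; have [+ _] := SP u; lra.
Qed.

Lemma critical_solution (lambda : R) (u : 'rV[R]_n) :
  energy_grad f lambda u = 0 -> is_solution f lambda u.
Proof.
by move=> Gu; apply: beam_solution => i; exact: critical_coord.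
Qed.

Lemma pad0 j : pad (0 : 'rV[R]_n) j = 0.
Proof. by apply: big1 => i _; rewrite mxE. Qed.

Lemma energy0 lambda : energy f lambda 0 = 0.
Proof.
rewrite /energy /beam_form !big1 ?mulr0 ?mul0r ?subr0// => k _.
  by rewrite mxE int0_0.
by rewrite /lap !pad0; ring.
Qed.

Lemma energy_grad0 lambda : energy_grad f lambda 0 = 0.
Proof.
apply/rowP => k; rewrite !mxE (superlinear_zero (@f_cont k) (@f_zero k) ltr01).1.
by rewrite /lap !pad0; ring.
Qed.

Lemma two_critical_points (lambda : R) (v : 'rV[R]_n) :
  0 <= lambda -> energy f lambda v < 0 ->
  exists u1 u2 : 'rV[R]_n, [/\ u1 <> u2, u1 <> 0, u2 <> 0,
    energy_grad f lambda u1 = 0 & energy_grad f lambda u2 = 0].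
Proof.
move=> l0 v0.
have fc k : continuous (f k) by move=> x; exact: (@f_cont k x).
have Jc := @energy_continuous R n f lambda fc.
have Gc := @energy_grad_continuous R n f lambda fc.
have Jd := @energy_descent R n f lambda fc.
have Jk a : compact [set u : 'rV[R]_n | energy f lambda u <= a].
  exact: energy_coercive.
have [e emin] := exists_minimizer Jc Jk.
have Ge := minimizer_critical Jd emin.
have e0 : energy f lambda e < 0 by exact: le_lt_trans (emin v) v0.
have [q q0 qP] := energy_barrier l0.
have [r [r0 rP]] := filter_ex (filterI (nbhs_right_gt (0 : R)) qP).
(* Inside the ball of radius [r] the energy is nonnegative, whereas it is negative at the
   minimizer. *)
have re : r < `|e|.
  rewrite ltNge; apply/negP => er; have := rP e er.
  by have := mulr_ge0 (ltW q0) (sqn_ge0 e); lra.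
have [|u|u Gu uE] := @mountain_pass _ _ _ _ Jc Gc Jd Jk r (q * r ^+ 2) e
  (energy_grad0 lambda) Ge.
- by rewrite !ltW.
- move=> ur; apply: le_trans (rP u _); last by rewrite ur.
  by rewrite ler_pM2l// -ur norm_le_sqn.
have rho0 : 0 < q * r ^+ 2 by rewrite mulr_gt0// exprn_gt0.
(* The three points are told apart by their energies: negative at [e], zero at [0], positive at
   [u]. *)
exists e, u; split=> // E.
- by move: uE; rewrite -E; lra.
- by move: e0; rewrite E energy0 ltxx.
- by move: uE; rewrite E energy0; lra.
Qed.
End Problem.

Theorem proposition1p1 (R : realType) (n : nat) (n_gt0 : (0 < n)%N)
    (f : 'I_n -> R -> R)
    (f_cont : forall k, continuous (f k))
    (F_sup : (0 < ereal_sup (range (fun t : R =>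
                 (\sum_(k < n) int0 (f k) t)%:E)))%E)
    (f_pinfty : forall k, f k s / s @[s --> +oo] --> (0 : R))
    (f_ninfty : forall k, f k s / s @[s --> -oo] --> (0 : R))
    (f_zero : forall k, f k s / s @[s --> (0 : R)^'] --> (0 : R)) :
  exists (Lambda : set R) (gamma : R),
    [/\ open Lambda, is_interval Lambda, Lambda !=set0,
        Lambda `<=` [set lambda | 0 < lambda] & 0 < gamma] /\
    forall lambda : R, Lambda lambda ->
      exists u1 u2 : 'rV[R]_n,
        [/\ u1 <> u2,
            u1 <> 0 /\ u2 <> 0,
            is_solution f lambda u1 /\ is_solution f lambda u2
          & norm2 u1 < gamma /\ norm2 u2 < gamma].
Proof.
have [_ [t _ <-] Ft] := ereal_sup_gt F_sup.
rewrite lte_fin in Ft; pose v : 'rV[R]_n := const_mx t.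
set F := \sum_(k < n) _ in Ft.
have Q0 : 0 <= beam_form v v.
  by apply: sumr_ge0 => j _; rewrite -expr2 sqr_ge0.
pose l0 := beam_form v v / (2 * F).
have l0_ge0 : 0 <= l0 by rewrite divr_ge0// mulr_ge0// ltW.
have [M MP] : exists M : R, forall (lambda : R) (u : 'rV[R]_n),
    0 <= lambda <= l0 + 1 -> energy_grad f lambda u = 0 -> sqn u <= M.
  by apply: critical_bounded => //; rewrite addr_ge0.
(* Above [l0] the energy of [v] is negative; the upper end keeps [lambda] in the range where [M] is
   uniform. The added 1 makes the norm bound strict. *)
exists `]l0, l0 + 1[%classic, (Num.sqrt M + 1); split.
  split; [exact: interval_open|exact: interval_is_interval| | |].
  - by exists (l0 + 1 / 2); rewrite /= in_itv/=; lra.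
  - by move=> l /=; rewrite in_itv/= => /andP[+ _]; exact: le_lt_trans.
  - by rewrite ltr_wpDl ?sqrtr_ge0.
move=> l /=; rewrite in_itv/= => /andP[l0l ll1].
have l_ge0 : 0 <= l by rewrite (le_trans l0_ge0)// ltW.
have Jv : energy f l v < 0.
  rewrite /energy (eq_bigr (fun k => int0 (f k) t)) => [|k _]; last by rewrite mxE.
  rewrite -/F; move: l0l; rewrite /l0 ltr_pdivrMr ?mulr_gt0//; lra.
have [u1 [u2 [u12 u1n u2n G1 G2]]] :=
  two_critical_points f_cont f_pinfty f_ninfty f_zero l_ge0 Jv.
have lL : 0 <= l <= l0 + 1 by rewrite l_ge0 ltW.
have bnd u : energy_grad f l u = 0 -> norm2 u < Num.sqrt M + 1.
  move=> /(MP _ _ lL) uM; rewrite (le_lt_trans (ler_wsqrtr uM))//.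
  by rewrite ltrDl.
exists u1, u2; split=> //; split; [exact: critical_solution|
  exact: critical_solution|exact: bnd|exact: bnd].
Qed.
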